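(* Assume that $\bar y\in\mathcal S(\bar x)$, that $f(x,y)$ is jointly concave in $(x,y)$, and that (each component of) $g(x,y)$ is jointly quasiconvex in $(x,y)$. Suppose that there is an open set $\mathcal O\ni\bar x$ such that, for every $x\in\mathcal O$, $\mathcal F(x)$ is nonempty and $f(x,\cdot)$ is bounded above on $\mathcal F(x)$. Assume that a constraint qualification holds for the system $g(x,y)\le0$ (in the variables $(x,y)$) at $(\bar x,\bar y)$. Then $V$ is concave, Lipschitz continuous at $\bar x$, and $$\partial V(\bar x)\subseteq\{\nabla_x\mathcal L(\bar x,\bar y,\lambda):\lambda\in\Sigma(\bar x,\bar y)\}.$$
   Context: Let $f:\mathbb R^{n+m}\to\mathbb R$ and $g:\mathbb R^{n+m}\to\mathbb R^q$ be continuously differentiable. For $x\in\mathbb R^n$ let $\mathcal F(x)=\{y\in\mathbb R^m:g(x,y)\le0\}$, $V(x)=\sup\{f(x,y):y\in\mathcal F(x)\}$ (with $V(x)=-\infty$ if $\mathcal F(x)=\emptyset$) and $\mathcal S(x)=\{y\in\mathcal F(x):f(x,y)=V(x)\}$. For a vector-valued map, $\nabla$ denotes the transposed Jacobian. $\mathcal L(x,y,\lambda)=f(x,y)-g(x,y)^\top\lambda$ and $\Sigma(x,y)=\{\lambda:\nabla_y\mathcal L(x,y,\lambda)=0,\ 0\le -g(x,y)\perp\lambda\ge0\}$. A constraint qualification (CQ) at a feasible point $\bar z$ of a system $G(z)\le0$ ($G$ continuously differentiable) is a condition on the system ensuring that whenever $\bar z$ is a local minimizer, over the feasible set, of a continuously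 differentiable function $\varphi$, the KKT conditions hold: there is $a\ge0$ with $a\perp G(\bar z)$ and $\nabla\varphi(\bar z)+\nabla G(\bar z)a=0$. For $\varphi:\mathbb R^n\to[-\infty,\infty]$ finite at $x^*$: $\widehat\partial\varphi(x^* )=\{w:\varphi(x)\ge\varphi(x^* )+w^\top(x-x^* )+o(\|x-x^*\|)\}$, and the limiting subdifferential $\partial\varphi(x^* )$ is the set of limits of $w^k\in\widehat\partial\varphi(x^k)$ with $x^k\to x^*$, $\varphi(x^k)\to\varphi(x^* )$. Lipschitz continuous at $\bar x$ means finite and Lipschitz on a neighborhood of $\bar x$. *)

(* Defs.v *)
From HB Require Import structures.
From mathcomp Require Import all_boot all_order all_algebra.
From mathcomp Require Import all_classical all_reals all_analysis.
Set Implicit Arguments.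
Unset Strict Implicit.
Unset Printing Implicit Defensive.
Import Order.TTheory GRing.Theory Num.Theory.
Import numFieldNormedType.Exports.
Local Open Scope classical_set_scope.
Local Open Scope ring_scope.

(* Points of R^N are row vectors; gradients, subgradients and multipliers are
   column vectors, so that the pairing w^T x is written (x *m w) 0 0.
   The library Jacobian satisfies 'D_v G z = v *m 'J G z for differentiable G:
   it is the N x q matrix of the partial derivatives, i.e., the transposed
   Jacobian in the usual convention. The norm on 'rV_n is the sup norm, which is
   equivalent to the Euclidean norm. *)

Section smooth.
Context {R : realType}.

Definition grad (n : nat) (phi : 'rV[R]_n -> R) (z : 'rV[R]_n) : 'cV[R]_n :=
  \col_i 'D_(delta_mx 0 i) phi z.

(* For a finite-dimensional domain, continuity of every directional derivative
   is continuity of the differential. *)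
Definition continuously_differentiable (n : nat) (W : normedModType R)
    (F : 'rV[R]_n -> W) : Prop :=
  (forall z, differentiable F z) /\
  (forall v, continuous (fun z => 'D_v F z)).

End smooth.

Section convexity.
Context {R : realType}.

Definition concave_function (n : nat) (f : 'rV[R]_n -> R) : Prop :=
  convex_function setT (fun z : 'rV[R]_n => - f z).

Definition quasiconvex_function (n : nat) (h : 'rV[R]_n -> R) : Prop :=
  forall (t : R) (z1 z2 : 'rV[R]_n), 0 <= t <= 1 ->
    h (t *: z1 + (1 - t) *: z2) <= Num.max (h z1) (h z2).

(* On \bar R, -oo + +oo = -oo, so this says that the hypograph is convex. *)
Definition concave_efunction (n : nat) (phi : 'rV[R]_n -> \bar R) : Prop :=
  forall (t : R) (x1 x2 : 'rV[R]_n), 0 < t < 1 ->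
    (t%:E * phi x1 + (1 - t)%R%:E * phi x2 <= phi (t *: x1 + (1 - t) *: x2)%R)%E.

End convexity.

Section subdifferentials.
Context {R : realType} {n : nat}.
Implicit Types (phi : 'rV[R]_n -> \bar R) (x : 'rV[R]_n).

Definition elipschitz_at phi x : Prop :=
  exists U : set 'rV[R]_n, [/\ nbhs x U,
    forall x', U x' -> phi x' \is a fin_num &
    [lipschitz fine (phi x') | x' in U]].

(* Empty where phi is not finite. *)
Definition regular_subdifferential phi x : set 'cV[R]_n :=
  [set w | phi x \is a fin_num /\
    exists r : 'rV[R]_n -> R, r =o_x (fun x' => x' - x) /\
      \forall x' \near x,
        (phi x + (((x' - x)%R *m w) 0 0)%:E + (r x')%:E <= phi x')%E].

Definition limiting_subdifferential phi x : set 'cV[R]_n :=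
  [set w | phi x \is a fin_num /\
    exists (xk : nat -> 'rV[R]_n) (wk : nat -> 'cV[R]_n),
      [/\ forall k, regular_subdifferential phi (xk k) (wk k),
          xk @ \oo --> x,
          phi (xk k) @[k --> \oo] --> phi x &
          wk @ \oo --> w]].

End subdifferentials.

Section constraint_qualification.
Context {R : realType} {N q : nat}.
Implicit Types (G : 'rV[R]_N -> 'rV[R]_q) (phi : 'rV[R]_N -> R).

Definition solution_set G : set 'rV[R]_N := [set z | forall j, G z 0 j <= 0].

Definition local_minimizer phi (A : set 'rV[R]_N) (z : 'rV[R]_N) : Prop :=
  A z /\ \forall z' \near z, A z' -> phi z <= phi z'.

Definition KKT phi G (z : 'rV[R]_N) : Prop :=
  exists a : 'cV[R]_q, [/\ forall j, 0 <= a j 0,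
    (G z *m a) 0 0 = 0 &
    grad phi z + 'J G z *m a = 0].

(* CQ G z reads: the condition CQ holds for the system G <= 0 at z. *)
Definition is_constraint_qualification
    (CQ : ('rV[R]_N -> 'rV[R]_q) -> 'rV[R]_N -> Prop) : Prop :=
  forall G z, continuously_differentiable G -> solution_set G z -> CQ G z ->
  forall phi, continuously_differentiable phi ->
    local_minimizer phi (solution_set G) z -> KKT phi G z.

End constraint_qualification.

Section parametric_program.
Context {R : realType} {n m q : nat}.
Variables (f : 'rV[R]_(n + m) -> R) (g : 'rV[R]_(n + m) -> 'rV[R]_q).

Definition feasible_map (x : 'rV[R]_n) : set 'rV[R]_m :=
  [set y | forall j, g (row_mx x y) 0 j <= 0].

Definition value_function (x : 'rV[R]_n) : \bar R :=
  ereal_sup [set (f (row_mx x y))%:E | y in feasible_map x].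

Definition solution_map (x : 'rV[R]_n) : set 'rV[R]_m :=
  [set y | feasible_map x y /\ (f (row_mx x y))%:E = value_function x].

Definition lagrangian (x : 'rV[R]_n) (y : 'rV[R]_m) (lambda : 'cV[R]_q) : R :=
  f (row_mx x y) - (g (row_mx x y) *m lambda) 0 0.

Definition grad_x_lagrangian (x : 'rV[R]_n) (y : 'rV[R]_m)
    (lambda : 'cV[R]_q) : 'cV[R]_n :=
  grad (fun x' => lagrangian x' y lambda) x.

Definition grad_y_lagrangian (x : 'rV[R]_n) (y : 'rV[R]_m)
    (lambda : 'cV[R]_q) : 'cV[R]_m :=
  grad (fun y' => lagrangian x y' lambda) y.

Definition multipliers (x : 'rV[R]_n) (y : 'rV[R]_m) : set 'cV[R]_q :=
  [set lambda | [/\ grad_y_lagrangian x y lambda = 0,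
    forall j, 0 <= - g (row_mx x y) 0 j,
    (- g (row_mx x y) *m lambda) 0 0 = 0 &
    forall j, 0 <= lambda j 0]].

End parametric_program.

(* Main.v *)
From HB Require Import structures.
Require Import Defs.
From mathcomp Require Import all_boot all_order all_algebra.
From mathcomp Require Import all_classical all_reals all_analysis.
From mathcomp Require Import ring lra.
Import Order.TTheory GRing.Theory Num.Theory.
Import numFieldNormedType.Exports.
Local Open Scope classical_set_scope.
Local Open Scope ring_scope.

(** Quasiconvexity of the constraints makes the feasible set in the joint
    variable (x, y) convex, so that concavity of f passes to the marginal
    supremum V (value_function_concave).

    V is finite on a neighborhood of xbar, and a concave function that is finite
    near a point is Lipschitz there (concave_efunction_lipschitz_at): it is
    bounded below by finitely many of its values, hence bounded above by
    reflection through the point, hence its slopes are bounded.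

    For the subdifferential, observe that a lower subgradient of a concave
    function is automatically an upper one: if V lies above an affine function
    to first order at a point, concavity keeps V below that affine function
    everywhere (regular_subgradient_supergradient). This property is closed
    under limits, so every w in the limiting subdifferential of V at xbar
    satisfies V(x) <= V(xbar) + (x - xbar) w for all x
    (limiting_subgradient_supergradient). Since f(x, y) <= V(x) at every
    feasible (x, y), with equality at (xbar, ybar), the point (xbar, ybar)
    minimizes x w - f(x, y) over the solution set of the system g <= 0. The
    constraint qualification provides a KKT multiplier for this problem. The
    y-block of the KKT equation says that the multiplier belongs to the
    multiplier set at (xbar, ybar), and its x-block says that w is the
    x-gradient of the Lagrangian. *)

(** * Pairing of rows and columns *)

Lemma cvg_pairing {R : realType} {N : nat} {T : Type} {F : set_system T}
    {FF : Filter F} (u : T -> 'rV[R]_N) (w : T -> 'cV[R]_N)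
    (u0 : 'rV[R]_N) (w0 : 'cV[R]_N) :
  u @ F --> u0 -> w @ F --> w0 ->
  ((u t *m w t) 0 0 @[t --> F] --> (u0 *m w0) 0 0).
Proof.
move=> uu0 ww0; rewrite mxE.
under eq_fun do rewrite mxE.
apply: cvg_big => [|j _]; first exact: add_continuous.
apply: cvgM.
  exact: (cvg_comp _ _ uu0 (@coord_continuous R 1 N 0 j u0)).
exact: (cvg_comp _ _ ww0 (@coord_continuous R N 1 j 0 w0)).
Qed.

Section pairing.
Context {R : realType} {q : nat} (a : 'cV[R]_q).

(** Named so that the general theory of linear maps applies to it. *)
Definition pairing (u : 'rV[R]_q) : R := (u *m a) 0 0.

Lemma pairing_is_linear : linear pairing.
Proof. by move=> k u v; rewrite /pairing mulmxDl -scalemxAl !mxE. Qed.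

HB.instance Definition _ :=
  GRing.isLinear.Build R 'rV[R]_q R _ pairing pairing_is_linear.

Lemma continuous_pairing : continuous pairing.
Proof.
move=> u.
exact: (@cvg_pairing R q _ (nbhs u) _ id (fun=> a) u a cvg_id (cvg_cst a)).
Qed.

Lemma differentiable_pairing u : differentiable pairing u.
Proof. exact/linear_differentiable/continuous_pairing. Qed.

Lemma differentiable_pairing_comp {N : nat} (G : 'rV[R]_N -> 'rV[R]_q) z :
  differentiable G z -> differentiable (fun z => pairing (G z)) z.
Proof.
move=> dG; apply: differentiable_comp => //; exact: differentiable_pairing.
Qed.

Lemma derive_pairing_comp {N : nat} (G : 'rV[R]_N -> 'rV[R]_q) z v :
  differentiable G z -> 'D_v (fun z => pairing (G z)) z = pairing ('D_v G z).
Proof.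
move=> dG; have dp := differentiable_pairing (G z).
rewrite (deriveE _ (differentiable_pairing_comp G z dG)) (deriveE _ dG).
rewrite (diff_comp dG dp) /= diff_lin//; exact: continuous_pairing.
Qed.

End pairing.

(** * Gradients *)

Section gradients.
Context {R : realType}.

(** A directional derivative depends only on the restriction of the function to
    a line. Freezing one block of variables is an instance: the partial
    functions and F itself are compared along lines parallel to the axes. *)
Lemma derive_eq_on_lines {V1 V2 W : normedModType R} (f1 : V1 -> W)
    (f2 : V2 -> W) (a1 v1 : V1) (a2 v2 : V2) :
  (forall h : R, f1 (h *: v1 + a1) = f2 (h *: v2 + a2)) ->
  'D_v1 f1 a1 = 'D_v2 f2 a2.
Proof.
move=> f12; have f12a : f1 a1 = f2 a2.
  by have := f12 0; rewrite !scale0r !add0r.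
rewrite /derive; set q1 := (X in X @ _); set q2 := (X in _ = lim (X @ _)).
suff -> : q1 = q2 by [].
by apply/funext => h; rewrite /q1 /q2 /= f12 f12a.
Qed.

Lemma grad_row_mxl {n m : nat} (F : 'rV[R]_(n + m) -> R) x y :
  grad (fun x' : 'rV_n => F (row_mx x' y)) x = usubmx (grad F (row_mx x y)).
Proof.
apply/colP => i; rewrite !mxE.
have -> : delta_mx 0 (lshift m i) = row_mx (delta_mx 0 i) 0 :> 'rV[R]_(n + m).
  apply/rowP => j; rewrite !mxE eqxx /=.
  case: split_ordP => k ->; rewrite !mxE ?eqxx/= ?eq_lshift//.
  by rewrite eq_rlshift.
apply: derive_eq_on_lines => h.
by rewrite scale_row_mx scaler0 add_row_mx add0r.
Qed.

Lemma grad_row_mxr {n m : nat} (F : 'rV[R]_(n + m) -> R) x y :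
  grad (fun y' : 'rV_m => F (row_mx x y')) y = dsubmx (grad F (row_mx x y)).
Proof.
apply/colP => i; rewrite !mxE.
have -> : delta_mx 0 (rshift n i) = row_mx 0 (delta_mx 0 i) :> 'rV[R]_(n + m).
  apply/rowP => j; rewrite !mxE eqxx /=.
  case: split_ordP => k ->; rewrite !mxE ?eqxx/= ?eq_rshift//.
  by rewrite eq_lrshift.
apply: derive_eq_on_lines => h.
by rewrite scale_row_mx scaler0 add_row_mx add0r.
Qed.

Lemma grad_sub_pairing {N q : nat} (f : 'rV[R]_N -> R)
    (g : 'rV[R]_N -> 'rV[R]_q) (a : 'cV[R]_q) z :
  differentiable f z -> differentiable g z ->
  grad (fun z' => f z' - (g z' *m a) 0 0) z = grad f z - 'J g z *m a.
Proof.
move=> df dg; apply/colP => i; rewrite mxE.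
rewrite deriveB; last 2 first.
- exact: diff_derivable.
- exact/diff_derivable/(differentiable_pairing_comp a).
rewrite -[X in _ - 'D__ X _]/(fun z' => pairing a (g z')).
rewrite derive_pairing_comp// deriveEjacobian// /pairing -mulmxA.
by rewrite -rowE !mxE.
Qed.

Lemma pairing_sub_C1 {N : nat} (w : 'cV[R]_N) (f : 'rV[R]_N -> R) :
  continuously_differentiable f ->
  continuously_differentiable (fun z => (z *m w) 0 0 - f z).
Proof.
move=> [df cf]; split=> [z|v].
  by apply: differentiableB => //; exact: (differentiable_pairing w).
have -> : (fun z => 'D_v (fun z' : 'rV_N => (z' *m w) 0 0 - f z') z) =
          (fun z => (v *m w) 0 0 - 'D_v f z).
  apply/funext => z; rewrite deriveB; last 2 first.
  - exact/diff_derivable/(differentiable_pairing w).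
  - exact: diff_derivable.
  rewrite -[X in 'D__ X _ - _]/(fun z' => pairing w (id z')).
  by rewrite derive_pairing_comp// derive_id.
by move=> z; exact: (cvgB (cvg_cst _) (cf v z)).
Qed.

Lemma grad_pairing_sub {N : nat} (w : 'cV[R]_N) (f : 'rV[R]_N -> R) z :
  differentiable f z ->
  grad (fun z' : 'rV_N => (z' *m w) 0 0 - f z') z = w - grad f z.
Proof.
move=> df; apply/colP => i; rewrite !mxE deriveB; last 2 first.
- exact/diff_derivable/(differentiable_pairing w).
- exact: diff_derivable.
rewrite -[X in 'D__ X _ - _]/(fun z' => pairing w (id z')).
by rewrite derive_pairing_comp// derive_id /pairing -rowE mxE.
Qed.

End gradients.

(** * Concave functions with extended real values *)

Lemma lee_real_approx {R : realType} (u : \bar R) (b : R) :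
  (forall s : R, (s%:E <= u)%E -> s <= b) -> (u <= b%:E)%E.
Proof.
case: u => [r|H|_]; last exact: leNye.
- by move=> H; rewrite lee_fin; exact: H.
- by have := H (b + 1) (leey _); rewrite gerDl ler10.
Qed.

Section concave_extended.
Context {R : realType} {n : nat}.
Context {phi : 'rV[R]_n -> \bar R} (phi_concave : concave_efunction phi).

(** Real lower bounds in place of the values of phi keep infinite values out of
    the sum, so that ordinary real arithmetic applies to it. *)
Lemma concave_efunction_ge (t a b : R) (x1 x2 : 'rV[R]_n) : 0 < t < 1 ->
  (a%:E <= phi x1)%E -> (b%:E <= phi x2)%E ->
  ((t * a + (1 - t) * b)%:E <= phi (t *: x1 + (1 - t) *: x2))%E.
Proof.
move=> /[dup] t01 /andP[t0 t1] ax1 bx2.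
apply: le_trans (phi_concave t x1 x2 t01).
by rewrite EFinD !EFinM leeD// lee_pmul2l// lte_fin ?subr_gt0.
Qed.

(** The average of k + 1 points is a convex combination of the first point and
    of the average of the others, with weights 1 / (k + 1) and k / (k + 1). *)
Lemma concave_efunction_average_ge (c : R) (k : nat) (v : 'I_k.+1 -> 'rV[R]_n) :
  (forall i, (c%:E <= phi (v i))%E) ->
  (c%:E <= phi (k.+1%:R^-1 *: \sum_(i < k.+1) v i))%E.
Proof.
elim: k v => [|k IHk] v cv.
  by rewrite big_ord_recl big_ord0 addr0 invr1 scale1r.
rewrite big_ord_recl.
pose t : R := k.+2%:R^-1.
have k2 : k.+2%:R = 1 + k.+1%:R :> R by rewrite [RHS]addrC natr1.
have k1 : 0 < k.+1%:R :> R by rewrite ltr0Sn.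
have t01 : 0 < t < 1.
  by rewrite /t invr_gt0 ltr0Sn/= invf_lt1 ?ltr0Sn// k2 ltrDl.
have -> : k.+2%:R^-1 *: (v ord0 + \sum_(i < k.+1) v (lift ord0 i)) =
    t *: v ord0 +
    (1 - t) *: (k.+1%:R^-1 *: \sum_(i < k.+1) v (lift ord0 i)).
  rewrite scalerDr scalerA; congr (_ + _ *: _).
  rewrite /t k2; field.
  by rewrite !nat1r !pnatr_eq0.
have := concave_efunction_ge t c c _ _ t01 (cv ord0)
  (IHk _ (fun i => cv (lift ord0 i))).
by rewrite -mulrDl addrC subrK mul1r.
Qed.

(** Finitely many values of phi bound it from below. Let c be a lower bound of
    phi at x and at the 2n points x + s e_i, x - s e_i. By concavity c bounds
    phi on the n segments that join these points in pairs. Any x' close to x is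
    the average of x itself and of the n points x + (n + 1) (x' - x)_i e_i,
    which lie on these segments, so c bounds phi at x' as well. Averaging x with
    the other points makes the argument uniform in n, including n = 0. *)
Lemma concave_efunction_locally_bounded_below (x : 'rV[R]_n) :
  (\forall x' \near x, phi x' \is a fin_num) ->
  exists c : R, \forall x' \near x, (c%:E <= phi x')%E.
Proof.
move=> /nbhs_ballP[e /= e0 phi_fin].
pose s := e / 2; have s0 : 0 < s by rewrite divr_gt0.
have fine_vertex (i : 'I_n) (b : R) : `|b| <= s ->
    phi (x + b *: delta_mx 0 i) \is a fin_num.
  move=> bs; apply: phi_fin; rewrite mx_norm_ball /ball_/= opprD addrA subrr.
  rewrite sub0r normrN normrZ (le_lt_trans (y := `|b|))//; last first.
    by rewrite (le_lt_trans bs)// /s ltr_pdivrMr// ltr_pMr// ltr1n.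
  rewrite ler_piMr// [leLHS]/Num.norm/= mx_normrE.
  apply/bigmax_leP; split=> // -[j k] _ /=.
  by rewrite mxE normr_nat lern1 leq_b1.
pose vertex (b : R) (i : 'I_n) := phi (x + b *: delta_mx 0 i).
pose c : R := - (`|fine (phi x)| +
  \sum_(i < n) (`|fine (vertex s i)| + `|fine (vertex (- s) i)|)).
have cx : (c%:E <= phi x)%E.
  rewrite -(@fineK _ (phi x)); last exact: phi_fin (ballxx _ _).
  rewrite lee_fin /c opprD (le_trans (y := - `|fine (phi x)|))//.
    by rewrite gerDl oppr_le0 sumr_ge0// => i _; rewrite addr_ge0.
  by rewrite lerNl -normrN ler_norm.
have c_vertex i : (c%:E <= vertex s i)%E /\ (c%:E <= vertex (- s)%R i)%E.
  have c_le (b : R) : `|b| <= s -> `|fine (vertex b i)| <=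
      `|fine (vertex s i)| + `|fine (vertex (- s) i)| -> (c%:E <= vertex b i)%E.
    move=> bs; rewrite -(@fineK _ (vertex b i)); last exact: fine_vertex.
    rewrite lee_fin /c (bigD1 i)//=.
    have : 0 <= \sum_(j < n | j != i)
        (`|fine (vertex s j)| + `|fine (vertex (- s) j)|).
      by rewrite sumr_ge0// => j _; rewrite addr_ge0.
    have := ler_norm (- fine (vertex b i)); rewrite normrN.
    have := normr_ge0 (fine (phi x)).
    move: (\sum_(j < n | _) _) (`|fine (phi x)|) (_ + `|fine (vertex _ _)|).
    by move=> S A B; lra.
  by split; apply: c_le; rewrite ?lerDl ?lerDr ?normrN ?(gtr0_norm s0).
have c_axis i (b : R) : `|b| < s -> (c%:E <= phi (x + b *: delta_mx 0 i)%R)%E.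
  rewrite ltr_norml => /andP[sb bs].
  pose t := (1 + b / s) / 2.
  have bs1 : -1 < b / s < 1.
    by rewrite ltr_pdivlMr// mulN1r sb ltr_pdivrMr// mul1r.
  have t01 : 0 < t < 1 by move: bs1; rewrite /t; lra.
  have -> : x + b *: delta_mx 0 i =
      t *: (x + s *: delta_mx 0 i) + (1 - t) *: (x + (- s) *: delta_mx 0 i).
    rewrite !scalerDr !scalerA addrACA -!scalerDl.
    rewrite [t + _]addrC subrK scale1r; congr (_ + _ *: _).
    by rewrite /t; field; rewrite gt_eqF.
  have [c1 c2] := c_vertex i.
  have := concave_efunction_ge t c c _ _ t01 c1 c2.
  by rewrite -mulrDl addrC subrK mul1r.
exists c; apply/nbhs_ballP; exists (s / n.+1%:R) => /=.
  by rewrite divr_gt0.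
move=> x'; rewrite mx_norm_ball /ball_/= -normrN opprB => x'x.
pose v (i : 'I_n.+1) : 'rV[R]_n :=
  if unlift ord0 i is Some j
  then x + (n.+1%:R * (x' - x) 0 j) *: delta_mx 0 j else x.
have -> : x' = n.+1%:R^-1 *: \sum_i v i.
  rewrite big_ord_recl /v unlift_none.
  under eq_bigr do rewrite liftK.
  rewrite big_split/= sumr_const card_ord addrA -mulrS.
  under eq_bigr do rewrite -scalerA.
  rewrite -scaler_sumr -row_sum_delta -[x *+ _]scaler_nat -scalerDr scalerA.
  by rewrite mulVf ?pnatr_eq0// scale1r addrC subrK.
apply: concave_efunction_average_ge => i; rewrite /v.
case: (unlift ord0 i) => // j.
apply: c_axis; rewrite normrM normr_nat mulrC -ltr_pdivlMr//.
apply: le_lt_trans x'x; rewrite [leRHS]/Num.norm/= mx_normrE.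
by apply/bigmax_geP; right => /=; exists (0, j).
Qed.

(** The standard passage from local bounds to a Lipschitz bound. The reflection
    z |-> 2 x - z turns the lower bound c into the upper bound M = 2 phi(x) - c.
    For y and z at distance less than r from x, prolonging the segment from z to
    y by the length r beyond y stays where c <= phi <= M, and concavity
    on the prolonged segment bounds the slope between z and y by (M - c) / r. *)
Lemma concave_efunction_lipschitz_at (x : 'rV[R]_n) :
  (\forall x' \near x, phi x' \is a fin_num) -> elipschitz_at phi x.
Proof.
move=> /[dup] phi_fin /concave_efunction_locally_bounded_below[c phi_ge].
have : \forall z \near x, phi z \is a fin_num /\ (c%:E <= phi z)%E.
  exact: filterI.
move=> /nbhs_ballP[e /= e0 phi_e].
have {phi_fin phi_ge} phi_e z : `|z - x| < e ->
    phi z \is a fin_num /\ c <= fine (phi z).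
  move=> zx; have [] := phi_e z.
    by rewrite mx_norm_ball /ball_/= -normrN opprB.
  by move=> fz cz; split=> //; rewrite -lee_fin fineK.
pose r := e / 2; have r0 : 0 < r by rewrite divr_gt0.
have re : e = r + r by rewrite /r -splitr.
have xe : `|x - x| < e by rewrite subrr normr0.
have fine_ge (t : R) z1 z2 : 0 < t < 1 -> `|z1 - x| < e -> `|z2 - x| < e ->
    `|t *: z1 + (1 - t) *: z2 - x| < e ->
    t * fine (phi z1) + (1 - t) * fine (phi z2) <=
    fine (phi (t *: z1 + (1 - t) *: z2)).
  move=> t01 /phi_e[f1 _] /phi_e[f2 _] /phi_e[f12 _].
  rewrite -lee_fin (fineK f12).
  by apply: concave_efunction_ge; rewrite ?fineK.
pose M := 2 * fine (phi x) - c.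
have fine_leM z : `|z - x| < e -> fine (phi z) <= M.
  move=> zx; have z'x : `|(2 *: x - z) - x| < e.
    by rewrite scaler_nat mulr2n addrAC addrK -normrN opprB.
  have mid : 2^-1 *: z + (1 - 2^-1) *: (2 *: x - z) = x.
    have -> : 1 - 2^-1 = 2^-1 :> R by lra.
    by rewrite -scalerDr addrC subrK scalerA mulVf ?pnatr_eq0// scale1r.
  have t01 : 0 < (2^-1 : R) < 1 by lra.
  have := fine_ge _ _ _ t01 zx z'x; rewrite mid => /(_ xe).
  have [_ ] := phi_e _ z'x; rewrite /M.
  move: (fine (phi z)) (fine (phi x)) (fine (phi _)) => p1 p2 p3; lra.
have cM : c <= M by apply: le_trans (fine_leM _ xe); have [] := phi_e _ xe.
have slope y z : `|y - x| < r -> `|z - x| < r ->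
    fine (phi z) - fine (phi y) <= (M - c) / r * `|y - z|.
  move=> yx zx; have [->|yz] := eqVneq y z.
    by rewrite !subrr normr0 mulr0.
  pose D := `|y - z|; have D0 : 0 < D by rewrite normr_gt0 subr_eq0.
  pose u := y + (r / D) *: (y - z); pose t := D / (r + D).
  have rD : 0 < r + D by rewrite addr_gt0.
  have t01 : 0 < t < 1.
    by rewrite /t divr_gt0//= ltr_pdivrMr// mul1r ltrDr.
  have ue : `|u - x| < e.
    rewrite /u addrAC (le_lt_trans (ler_normD _ _))// re ltr_leD// normrZ -/D.
    rewrite (ger0_norm (divr_ge0 (ltW r0) (ltW D0))).
    by rewrite divfK ?gt_eqF.
  have ye : `|y - x| < e by rewrite re (lt_le_trans yx)// lerDl ltW.
  have ze : `|z - x| < e by rewrite re (lt_le_trans zx)// lerDl ltW.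
  have yE : t *: u + (1 - t) *: z = y.
    rewrite /u scalerDr scalerA.
    have -> : t * (r / D) = 1 - t.
      by rewrite /t; field; rewrite !gt_eqF.
    by rewrite -addrA -scalerDr subrK -scalerDl addrC subrK scale1r.
  have := fine_ge t u z t01 ue ze; rewrite yE => /(_ ye) conc.
  have [_ cu] := phi_e _ ue; have zM := fine_leM _ ze.
  have [_ cz] := phi_e _ ze.
  case/andP: t01 => t0 t1.
  apply: (@le_trans _ _ (t * (M - c))).
    rewrite (@le_trans _ _ (t * (fine (phi z) - fine (phi u))))//; first by nra.
    by rewrite ler_pM2l// lerB.
  rewrite mulrC -[leRHS]mulrA ler_wpM2l ?subr_ge0//.
  by rewrite /t -/D mulrC ler_pM2r// lef_pV2 ?posrE// lerDl ltW.
exists (ball x r); split; first exact: nbhsx_ballx.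
- move=> z; rewrite mx_norm_ball /ball_/= -normrN opprB => zx.
  by apply: (phi_e _ _).1; rewrite re (lt_le_trans zx)// lerDl ltW.
- apply: (@klipschitzW _ _ _ ((M - c) / r)) => /=.
    by apply: (@globally_properfilter _ _ (x, x)); split; exact: ballxx.
  move=> -[y z]/= [].
  rewrite mx_norm_ball /ball_/= -normrN opprB -[`|x - z|]normrN opprB => yx zx.
  rewrite ler_norml; apply/andP; split; last first.
    by rewrite distrC; exact: slope.
  by rewrite lerNl opprB; exact: slope.
Qed.

End concave_extended.

(** * Subgradients of concave functions *)

Section subgradients.
Context {R : realType} {n : nat}.
Context {phi : 'rV[R]_n -> \bar R} (phi_concave : concave_efunction phi).

Definition supergradient (x : 'rV[R]_n) (w : 'cV[R]_n) : Prop :=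
  forall x', (phi x' <= phi x + (((x' - x) *m w) 0 0)%:E)%E.

(** For d := x' - x and small t > 0, the point x is a convex combination of
    x - t d and x', so that (1 + t) phi(x) >= phi(x - t d) + t phi(x'). A regular
    subgradient w bounds phi(x - t d) below by phi(x) - t (d w) - o(t); dividing
    by t gives phi(x') <= phi(x) + d w. The subgradient inequality, used in the
    direction opposite to x', thus turns into a majorization at x'. *)
Lemma regular_subgradient_supergradient (x : 'rV[R]_n) (w : 'cV[R]_n) :
  regular_subdifferential phi x w -> supergradient x w.
Proof.
move=> [phix [r [/eqoP r_o phi_ge]]] x'.
rewrite -(fineK phix) -EFinD; apply: lee_real_approx => s sx'.
apply/ler_addgt0Pr => e e0.
pose d := x' - x; pose l := (d *m w) 0 0.
have d1 : 0 < `|d| + 1 by rewrite ltr_wpDl.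
(* This tolerance makes the remainder at x - t d at most t e; adding 1 to the
   norm of d avoids a separate treatment of d = 0. *)
have e'0 : 0 < e / (`|d| + 1) by rewrite divr_gt0.
have : \forall z \near x, `|r z| <= e / (`|d| + 1) * `|z - x| /\
    (phi x + (((z - x)%R *m w) 0 0)%:E + (r z)%:E <= phi z)%E.
  by apply: filterI => //; exact: r_o.
move=> /nbhs_ballP[del /= del0 near_x].
pose t := del / 2 / (`|d| + 1).
have t0 : 0 < t by rewrite !divr_gt0.
have td : t * `|d| < del.
  rewrite /t mulrAC ltr_pdivrMr// mulrC.
  have := normr_ge0 d; nra.
pose z := x - t *: d.
have zx : z - x = - (t *: d) by rewrite /z addrAC subrr sub0r.
have [|rz phiz] := near_x z.
  rewrite mx_norm_ball /ball_/= -normrN opprB zx normrN normrZ.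
  by rewrite gtr0_norm.
have {}rz : - (t * e) <= r z.
  suff : `|r z| <= t * e by rewrite ler_norml => /andP[].
  apply: le_trans rz _; rewrite zx normrN normrZ gtr0_norm//.
  rewrite mulrAC ler_pdivrMr//; have := normr_ge0 d; nra.
have {}phiz : ((fine (phi x) - t * l - t * e)%:E <= phi z)%E.
  apply: le_trans phiz; rewrite -[in leRHS](fineK phix) -!EFinD lee_fin.
  rewrite zx mulNmx -scalemxAl !mxE -/l lerD// lerD2l.
  by rewrite /l mxE.
pose tau := (1 + t)^-1.
have t1 : 0 < 1 + t by rewrite addr_gt0.
have tau01 : 0 < tau < 1.
  by rewrite /tau invr_gt0 t1/= invf_lt1// ltrDl.
have xE : tau *: z + (1 - tau) *: x' = x.
  have -> : x' = x + d by rewrite /d addrC subrK.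
  have -> : 1 - tau = tau * t by rewrite /tau; field; rewrite gt_eqF.
  have zd : z + t *: (x + d) = (1 + t) *: x.
    by rewrite /z (scalerDr t x d) addrACA addNr addr0 scalerDl scale1r.
  by rewrite -scalerA -scalerDr zd scalerA mulVf ?gt_eqF// scale1r.
have := concave_efunction_ge phi_concave _ _ _ _ _ tau01 phiz sx'.
rewrite xE -(fineK phix) lee_fin -/d -/l.
have -> : 1 - tau = tau * t by rewrite /tau; field; rewrite gt_eqF.
rewrite -[tau * t * s]mulrA -mulrDr /tau mulrC ler_pdivrMr// => H.
rewrite -(ler_pM2l t0); lra.
Qed.

(** Supergradients are characterized by non-strict inequalities, one for each
    point x', which survive the limit that defines the limiting
    subdifferential. *)
Lemma limiting_subgradient_supergradient (x : 'rV[R]_n) (w : 'cV[R]_n) :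
  limiting_subdifferential phi x w -> supergradient x w.
Proof.
move=> [phix [xk [wk [reg_k cvg_x cvg_phi cvg_w]]]] x'.
rewrite -(fineK phix) -EFinD; apply: lee_real_approx => s sx'.
have lim_rhs : (fine (phi (xk k)) + ((x' - xk k) *m wk k) 0 0) @[k --> \oo] -->
    fine (phi x) + ((x' - x) *m w) 0 0.
  apply: cvgD; first by apply: fine_cvg; rewrite fineK.
  by apply: cvg_pairing => //; apply: cvgB => //; exact: cvg_cst.
apply: (cvgr_to_ge lim_rhs); apply: nearW => k.
have [phik _] := reg_k k.
rewrite -lee_fin EFinD (fineK phik).
by apply: le_trans sx' _; exact: regular_subgradient_supergradient.
Qed.

End subgradients.

(** * The value function *)

Lemma concave_function_ge {R : realType} {N : nat} (h : 'rV[R]_N -> R) (t : R)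
    z1 z2 :
  concave_function h -> 0 <= t <= 1 ->
  t * h z1 + (1 - t) * h z2 <= h (t *: z1 + (1 - t) *: z2).
Proof.
move=> ch /andP[t0 t1].
have := ch (Itv01 t0 t1) z1 z2 (in_setT _) (in_setT _).
rewrite convRE /= !mulrN -opprD lerN2; exact.
Qed.

Section value_function.
Context {R : realType} {n m q : nat}.
Context {f : 'rV[R]_(n + m) -> R} {g : 'rV[R]_(n + m) -> 'rV[R]_q}.

Lemma value_function_ge x y :
  feasible_map g x y -> ((f (row_mx x y))%:E <= value_function f g x)%E.
Proof. by move=> Fy; apply: ereal_sup_ubound; exists y. Qed.

Lemma feasible_map_convex (t : R) x1 x2 y1 y2 :
  (forall j, quasiconvex_function (fun z => g z 0 j)) -> 0 <= t <= 1 ->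
  feasible_map g x1 y1 -> feasible_map g x2 y2 ->
  feasible_map g (t *: x1 + (1 - t) *: x2) (t *: y1 + (1 - t) *: y2).
Proof.
move=> qg t01 Fy1 Fy2 j.
rewrite -add_row_mx -!scale_row_mx (le_trans (qg j _ _ _ t01))//.
by rewrite ge_max Fy1 Fy2.
Qed.

(** A convex combination of feasible decisions at x1 and x2 is feasible at the
    corresponding combination of x1 and x2, where concavity of f bounds its
    value from below. The suprema over the two feasible sets are then taken one
    after the other; for the second one the supremum at x1 is a fixed extended
    real, and its infinite values are treated apart: if it is +oo, any feasible
    point at x2 forces +oo at the combination, while an empty feasible set at
    x2 makes the left-hand side -oo. *)
Lemma value_function_concave : concave_function f ->
  (forall j, quasiconvex_function (fun z => g z 0 j)) ->
  concave_efunction (value_function f g).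
Proof.
move=> cf qg t x1 x2 /andP[t0 t1].
set V := value_function f g; set x := (_ *: _ + _)%R.
have t'0 : 0 < 1 - t by rewrite subr_gt0.
have t01 : 0 <= t <= 1 by rewrite (ltW t0) ltW.
have one_sided y2 : feasible_map g x2 y2 ->
    (t%:E * V x1 + ((1 - t) * f (row_mx x2 y2))%:E <= V x)%E.
  move=> Fy2; rewrite -leeBrDr// -lee_pdivlMl//.
  apply: ge_ereal_sup => _ [y1 Fy1 <-].
  rewrite lee_pdivlMl// leeBrDr// -EFinM -EFinD.
  have Fy := feasible_map_convex _ _ _ _ _ qg t01 Fy1 Fy2.
  apply: le_trans (value_function_ge _ _ Fy).
  by rewrite lee_fin -add_row_mx -!scale_row_mx; exact: concave_function_ge.
case V1 : (V x1) => [v1| |].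
- rewrite -leeBrDl// -lee_pdivlMl//.
  apply: ge_ereal_sup => _ [y2 Fy2 <-].
  rewrite lee_pdivlMl// leeBrDl//.
  by have := one_sided _ Fy2; rewrite V1 EFinM.
- have [[y2 Fy2]|] := pselect (feasible_map g x2 !=set0).
    have := one_sided _ Fy2; rewrite V1 gt0_muley ?lte_fin// addye//.
    by rewrite leye_eq => /eqP ->; rewrite leey.
  move/set0P/negP/negPn/eqP => F0.
  have -> : V x2 = -oo%E by rewrite /V /value_function F0 image_set0 ereal_sup0.
  by rewrite gt0_muleNy ?lte_fin// addeNy leNye.
- by rewrite gt0_muleNy ?lte_fin// addNye leNye.
Qed.

End value_function.

Theorem theorem3p2 (R : realType) (n m q : nat)
  (f : 'rV[R]_(n + m) -> R) (g : 'rV[R]_(n + m) -> 'rV[R]_q)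
  (f_C1 : continuously_differentiable f)
  (g_C1 : continuously_differentiable g)
  (xbar : 'rV[R]_n) (ybar : 'rV[R]_m)
  (ybar_sol : solution_map f g xbar ybar)
  (f_concave : concave_function f)
  (g_quasiconvex : forall j, quasiconvex_function (fun z => g z 0 j))
  (U : set 'rV[R]_n) (U_open : open U) (U_xbar : U xbar)
  (U_feasible : forall x, U x -> feasible_map g x !=set0)
  (U_bounded : forall x, U x ->
     has_ubound [set f (row_mx x y) | y in feasible_map g x])
  (CQ : ('rV[R]_(n + m) -> 'rV[R]_q) -> 'rV[R]_(n + m) -> Prop)
  (CQ_is_CQ : is_constraint_qualification CQ)
  (CQ_g : CQ g (row_mx xbar ybar)) :
  [/\ concave_efunction (value_function f g),
      elipschitz_at (value_function f g) xbar &
      limiting_subdifferential (value_function f g) xbar `<=`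
        [set grad_x_lagrangian f g xbar ybar lambda
           | lambda in multipliers f g xbar ybar]].
Proof.
have V_concave := value_function_concave f_concave g_quasiconvex.
have V_fin x : U x -> value_function f g x \is a fin_num.
  move=> Ux; have [y Fy] := U_feasible x Ux; have [M fM] := U_bounded x Ux.
  rewrite fin_numE -ltNye -ltey; apply/andP; split.
    by apply: lt_le_trans (value_function_ge _ _ Fy); exact: ltNyr.
  apply: (@le_lt_trans _ _ M%:E); last exact: ltry.
  apply: ge_ereal_sup => _ [y' Fy' <-].
  by rewrite lee_fin; apply: fM; exists y'.
split=> //.
  apply: concave_efunction_lipschitz_at => //.
  by apply: filterS V_fin _; exact: open_nbhs_nbhs.
move=> w /(limiting_subgradient_supergradient V_concave) w_super.
have [F_ybar f_ybar] := ybar_sol.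
set zbar := row_mx xbar ybar in f_ybar CQ_g *.
pose W : 'cV[R]_(n + m) := col_mx w 0.
(* For feasible z = (x, y) the supergradient inequality gives
   f z <= V x <= f zbar + (x - xbar) w. *)
have zbar_min : local_minimizer (fun z => (z *m W) 0 0 - f z)
    (solution_set g) zbar.
  split=> //; apply: (@nearW _ (nbhs zbar)) => z Fz.
  have Fz' : feasible_map g (lsubmx z) (rsubmx z).
    by rewrite /feasible_map /= hsubmxK.
  have := le_trans (value_function_ge _ _ Fz') (w_super _).
  rewrite -f_ybar hsubmxK -EFinD lee_fin mulmxBl mxE [X in _ + (_ + X)]mxE.
  rewrite -[in (z *m W)](hsubmxK z) !mul_row_col !mulmx0 !addr0; lra.
have [a [a0 comp stat]] := CQ_is_CQ g zbar g_C1 F_ybar CQ_g _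
  (pairing_sub_C1 W _ f_C1) zbar_min.
have [df _] := f_C1; have [dg _] := g_C1.
pose L z : R := f z - (g z *m a) 0 0.
have grad_L : grad L zbar = W.
  rewrite grad_sub_pairing//.
  move: stat; rewrite grad_pairing_sub// => /eqP.
  by rewrite addrAC subr_eq0 => /eqP <-; rewrite addrK.
exists a.
  split=> //.
  - have -> : grad_y_lagrangian f g xbar ybar a = dsubmx (grad L zbar).
      exact: (grad_row_mxr L).
    by rewrite grad_L col_mxKd.
  - by move=> j; rewrite oppr_ge0.
  - by rewrite mulNmx mxE comp oppr0.
have -> : grad_x_lagrangian f g xbar ybar a = usubmx (grad L zbar).
  exact: (grad_row_mxl L).
by rewrite grad_L col_mxKu.
Qed.
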